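(* For $i=1,\dots,m$ let $f_i:\mathbb{R}^d\to(-\infty,\infty]$ be closed, convex, proper and $L_i(\cdot)$-inexactly smooth. Then: 1. $\sum_{i=1}^mf_i$ is $L(\cdot)$-inexactly smooth with $L(\delta)=\inf\big\{\sum_{i=1}^mL_i(\delta_i):\ \sum_{i=1}^m\delta_i=\delta,\ \delta_i\ge0\big\}$; 2. $(\max_if_i^* )^*$, when proper, is $L(\cdot)$-inexactly smooth with $L(\delta)=\max_iL_i(\delta)$; 3. $\big(\sum_{i=1}^mf_i^*\big)^*$, when proper, is $L(\cdot)$-inexactly smooth with $L(\delta)=\Big(\sup\big\{\sum_{i=1}^m\frac1{L_i(\delta_i)}:\ \sum_{i=1}^m\delta_i=\delta,\ \delta_i\ge0\big\}\Big)^{-1}$.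
   Context: Norms are Euclidean; $1/\infty=0$, $1/0=\infty$; $f^*(g)=\sup_x\{\langle g,x\rangle-f(x)\}$ is the Fenchel conjugate. Each $L_i:[0,\infty)\to(0,\infty]$ is finite for all $\delta>0$, convex, lower semicontinuous, nonincreasing, and $-1/L_i(\cdot)$ is convex. A closed, convex, proper $f$ is $L(\cdot)$-inexactly smooth if for all $x,y\in\mathbb{R}^d$, all $g_x\in\partial f(x)$ (convex subdifferential) and all $\delta\ge0$: $f(y)\le f(x)+\langle g_x,y-x\rangle+\frac{L(\delta)}2\|y-x\|^2+\delta$ (nothing is imposed when $L(\delta)=\infty$). *)

(* Defs.v *)
From mathcomp Require Import all_boot all_order all_algebra.
From mathcomp Require Import all_classical all_reals all_analysis.
Import Order.TTheory GRing.Theory Num.Theory.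
Import numFieldNormedType.Exports.

Set Implicit Arguments.
Unset Strict Implicit.
Unset Printing Implicit Defensive.

Local Open Scope classical_set_scope.
Local Open Scope ring_scope.
Local Open Scope ereal_scope.

Definition dotp (R : realType) (d : nat) (x y : 'rV[R]_d) : R :=
  (\sum_(k < d) x ord0 k * y ord0 k)%R.

(* The library norm `|x| on 'rV[R]_d is the sup norm, hence this definition. *)
Definition enorm (R : realType) (d : nat) (x : 'rV[R]_d) : R :=
  Num.sqrt (dotp x x).

(* Meant for f > -oo, so that +oo - oo does not occur; t = 0 and t = 1 are left
   out to avoid 0 * +oo. *)
Definition econvex_on (R : realType) (V : lmodType R) (D : set V)
    (f : V -> \bar R) : Prop :=
  forall (x y : V) (t : R), D x -> D y -> (0 < t < 1)%R ->
    f (t *: x + (1 - t) *: y)%R <= t%:E * f x + (1 - t)%:E * f y.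

Definition closed_fun (R : realType) (d : nat) (f : 'rV[R]_d -> \bar R) : Prop :=
  closed [set p : 'rV[R]_d * R | f p.1 <= p.2%:E].

Definition proper_fun (R : realType) (d : nat) (f : 'rV[R]_d -> \bar R) : Prop :=
  (forall x, f x != -oo) /\ (exists x, f x != +oo).

Definition fenchel (R : realType) (d : nat) (f : 'rV[R]_d -> \bar R)
    (g : 'rV[R]_d) : \bar R :=
  ereal_sup [set (dotp g x)%:E - f x | x in [set: 'rV[R]_d]].

Definition subdifferential (R : realType) (d : nat) (f : 'rV[R]_d -> \bar R)
    (x : 'rV[R]_d) : set 'rV[R]_d :=
  [set g | forall y, f x + (dotp g (y - x)%R)%:E <= f y].

(* Functions L : [0, +oo[ -> ]0, +oo] are represented by L : R -> \bar R, whose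
   values at negative arguments are irrelevant.  Lower semicontinuity is that of
   the restriction of L to [0, +oo[, via the subspace topology.  The library
   inverse on \bar R satisfies 0^-1 = +oo and +oo^-1 = 0. *)
Record admissible (R : realType) (L : R -> \bar R) : Prop := Admissible {
  admissible_gt0 : forall delta : R, (0 <= delta)%R -> 0 < L delta ;
  admissible_fin : forall delta : R, (0 < delta)%R -> L delta < +oo ;
  admissible_convex : econvex_on (V := R^o) `[0%R, +oo[ L ;
  admissible_lsc :
    lower_semicontinuous (X := subspace (`[0%R, +oo[ : set R)) L ;
  admissible_nonincr : forall delta delta' : R,
    (0 <= delta)%R -> (delta <= delta')%R -> L delta' <= L delta ;
  admissible_Ninv_convex :
    econvex_on (V := R^o) `[0%R, +oo[ (fun delta => - (L delta)^-1) }.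

Record inexactly_smooth (R : realType) (d : nat) (L : R -> \bar R)
    (f : 'rV[R]_d -> \bar R) : Prop := InexactlySmooth {
  inexactly_smooth_closed : closed_fun f ;
  inexactly_smooth_convex : econvex_on setT f ;
  inexactly_smooth_proper : proper_fun f ;
  inexactly_smooth_le : forall (x y g : 'rV[R]_d) (delta : R),
    subdifferential f x g -> (0 <= delta)%R -> L delta < +oo ->
    f y <= f x + (dotp g (y - x)%R)%:E
           + L delta / 2%:E * (enorm (y - x)%R ^+ 2)%:E + delta%:E }.

Definition splittings (R : realType) (m : nat) (delta : R) : set ('I_m -> R) :=
  [set e | (\sum_i e i)%R = delta /\ forall i, (0 <= e i)%R].

Definition sum_modulus (R : realType) (m : nat) (L : 'I_m -> R -> \bar R)
    (delta : R) : \bar R :=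
  ereal_inf [set \sum_i L i (e i) | e in splittings delta].

Definition max_modulus (R : realType) (m : nat) (L : 'I_m -> R -> \bar R)
    (delta : R) : \bar R :=
  \big[maxe/-oo]_i L i delta.

Definition infconv_modulus (R : realType) (m : nat) (L : 'I_m -> R -> \bar R)
    (delta : R) : \bar R :=
  (ereal_sup [set \sum_i (L i (e i))^-1 | e in splittings delta])^-1.

(* Main.v *)
(* Inexact smoothness of f is encoded by a three-point inequality without
   subgradients, namely for 0 < tau < 1
     (1 - tau) f(a) + tau f(b) <= f((1 - tau) a + tau b)
                                  + tau (c/2 |b - a|^2 + delta),
   where c = L(delta).  Conjugation exchanges it with the inexact strong
   convexity
     h((1 - tau) g + tau g') + tau (rho/2 (1 - tau)^2 |g' - g|^2 - delta)
       <= (1 - tau) h(g) + tau h(g'),    rho = 1/c,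
   and letting tau tend to 0 gives back the subgradient inequality.  Each
   three-point inequality is visibly stable under the operation at hand: the
   first one under sums, the second one under sums and maxima.  No calculus of
   subdifferentials is needed; the only input from convex analysis is that the
   points with a subgradient are dense, which follows by projecting onto the
   epigraph. *)
Require Import Defs.
From mathcomp Require Import all_boot all_order all_algebra.
From mathcomp Require Import all_classical all_reals all_analysis.
From mathcomp Require Import ring lra.
Import Order.TTheory GRing.Theory Num.Theory.
Import numFieldNormedType.Exports.

Local Open Scope classical_set_scope.
Local Open Scope ring_scope.
Local Open Scope ereal_scope.

(** * The Euclidean inner product *)

Section InnerProduct.
Context {R : realType} {d : nat}.
Implicit Types (x y z : 'rV[R]_d) (a : R).
Local Open Scope ring_scope.

Lemma dotpC x y : dotp x y = dotp y x.
Proof. by apply: eq_bigr => k _; rewrite mulrC. Qed.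

Lemma dotpDl x y z : dotp (x + y) z = dotp x z + dotp y z.
Proof. by rewrite -big_split; apply: eq_bigr => k _; rewrite mxE mulrDl. Qed.

Lemma dotpZl a x y : dotp (a *: x) y = a * dotp x y.
Proof. by rewrite mulr_sumr; apply: eq_bigr => k _; rewrite mxE mulrA. Qed.

Lemma dotpNl x y : dotp (- x) y = - dotp x y.
Proof. by rewrite -scaleN1r dotpZl mulN1r. Qed.

Lemma dotpDr x y z : dotp x (y + z) = dotp x y + dotp x z.
Proof. by rewrite dotpC dotpDl !(dotpC x). Qed.

Lemma dotpZr a x y : dotp x (a *: y) = a * dotp x y.
Proof. by rewrite dotpC dotpZl dotpC. Qed.

Lemma dotpNr x y : dotp x (- y) = - dotp x y.
Proof. by rewrite dotpC dotpNl dotpC. Qed.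

Lemma dotp_sqrD x y : dotp (x + y) (x + y) = dotp x x + 2 * dotp x y + dotp y y.
Proof. by rewrite !dotpDr !dotpDl (dotpC y x); ring. Qed.

Lemma dotpr0 x : dotp x 0 = 0.
Proof. by rewrite -(scale0r 0) dotpZr mul0r. Qed.

Lemma sqr_coord_le_dotp x (k : 'I_d) : x ord0 k ^+ 2 <= dotp x x.
Proof.
rewrite /dotp (bigD1 k)//= -expr2 lerDl sumr_ge0// => j _.
by rewrite -expr2 sqr_ge0.
Qed.

Lemma dotp_ge0 x : 0 <= dotp x x.
Proof. by apply: sumr_ge0 => k _; rewrite -expr2 sqr_ge0. Qed.

Lemma dotp_eq0 x : dotp x x = 0 -> x = 0.
Proof.
move=> x0; apply/rowP => k; rewrite mxE; apply/eqP.
by rewrite -sqrf_eq0 eq_le sqr_ge0 andbT -x0 sqr_coord_le_dotp.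
Qed.

Lemma sqr_enorm x : enorm x ^+ 2 = dotp x x.
Proof. by rewrite sqr_sqrtr// dotp_ge0. Qed.

Lemma continuous_dotp {T : topologicalType} (u v : T -> 'rV[R]_d) :
  continuous u -> continuous v -> continuous (fun p => dotp (u p) (v p)).
Proof.
move=> cu cv p; rewrite /dotp; apply: (cvg_big (@add_continuous R^o)) => k _.
have coord (w : T -> 'rV[R]_d) : {for p, continuous w} ->
    {for p, continuous (fun q => w q ord0 k)}.
  move=> cw; apply: (@continuous_comp _ _ _ w (fun z => z ord0 k)) => //.
  exact: coord_continuous.
by apply: cvgM; apply: coord; [exact: cu|exact: cv].
Qed.

End InnerProduct.

(** * Closed convex functions and subgradients near a given point *)

Section ClosedConvex.
Context {R : realType} {d : nat}.
Implicit Types (f : 'rV[R]_d -> \bar R) (x y g : 'rV[R]_d).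

(** The hypothesis makes [f] the supremum of its affine minorants, so its epigraph is an
    intersection of closed half-spaces. *)
Lemma closed_fun_sup_affine f :
  (forall x (t : R), t%:E < f x -> exists g (c : R),
    (forall y, (dotp g y + c)%:E <= f y) /\ (t < dotp g x + c)%R) ->
  closed_fun f.
Proof.
move=> sup_f; pose A := [set gc : 'rV[R]_d * R |
  forall y, (dotp gc.1 y + gc.2)%:E <= f y].
rewrite /closed_fun (_ : mkset _ = \bigcap_(gc in A)
    [set p : 'rV[R]_d * R | (dotp gc.1 p.1 + gc.2 - p.2 <= 0)%R]).
  apply: closed_bigI => -[g c] _ /=.
  refine (@preimage_closed _ _ (fun p : 'rV[R]_d * R =>
    dotp g p.1 + c - p.2)%R _ _ (@closed_le R 0%R)) => p _.
  apply: cvgB; last exact: cvg_snd.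
  apply: cvgD; last exact: cvg_cst.
  by apply: continuous_dotp => q; [exact: cvg_cst|exact: cvg_fst].
apply/seteqP; split => -[x t] /=.
  move=> fxt [g c] /= Agc /=.
  by rewrite subr_le0 -lee_fin (le_trans _ fxt).
move=> h; rewrite leNgt; apply/negP => /sup_f[g [c [Agc]]].
by have /= := h (g, c) Agc; rewrite subr_le0 ltNge => ->.
Qed.

(** The squared distance to [(p, t0)] attains its minimum on the part of the epigraph in a compact
    box. The half-width [M] of the box is the distance to [(p, r)], so whatever lies outside is
    farther away than [(p, r)]. *)
Lemma epigraph_projection f (p : 'rV[R]_d) (r t0 : R) : closed_fun f ->
  f p <= r%:E -> exists (x : 'rV[R]_d) (t : R), f x <= t%:E /\
    forall y (u : R), f y <= u%:E ->
    (dotp (x - p) (x - p) + (t - t0) ^+ 2 <=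
     dotp (y - p) (y - p) + (u - t0) ^+ 2)%R.
Proof.
move=> clf fpr.
pose D (q : 'rV[R]_d * R) : R :=
  (dotp (q.1 - p) (q.1 - p) + (q.2 - t0) ^+ 2)%R.
pose M : R := `|r - t0|%R.
have DpM : (D (p, r) = M ^+ 2)%R.
  by rewrite /D/= subrr /M real_normK ?num_real// -(scale0r p) dotpZl mul0r add0r.
pose K : set ('rV[R]_d * R) :=
  [set v : 'rV[R]_d | forall k, v ord0 k \in `[p ord0 k - M, p ord0 k + M]%R]
    `*` `[(t0 - M)%R, (t0 + M)%R].
have cK : compact K.
  apply: compact_setX; last exact: segment_compact.
  apply: (@rV_compact _ _ (fun k => [set` `[p ord0 k - M, p ord0 k + M]%R])).
  by move=> k; exact: segment_compact.
have DK q : (D q <= M ^+ 2)%R -> K q.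
  have sqr_le (a b : R) : ((a - b) ^+ 2 <= M ^+ 2 -> b - M <= a <= b + M)%R.
    move=> abM; rewrite -ler_distl -ler_sqr ?nnegrE ?normr_ge0//.
    by rewrite real_normK ?num_real.
  move=> DM; split => [k|]; rewrite /= in_itv/=; apply: sqr_le;
    apply: le_trans DM; rewrite /D.
    apply: ler_wpDr; first exact: sqr_ge0.
    by have := sqr_coord_le_dotp (q.1 - p) k; rewrite !mxE.
  by rewrite lerDr dotp_ge0.
have cD : continuous D.
  have c1 : continuous (fun q : 'rV[R]_d * R => q.1 - p)%R.
    by move=> q; apply: cvgB; [exact: cvg_fst|exact: cvg_cst].
  have c2 : continuous (fun q : 'rV[R]_d * R => q.2 - t0)%R.
    by move=> q; apply: cvgB; [exact: cvg_snd|exact: cvg_cst].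
  move=> q; apply: cvgD; first exact: (continuous_dotp _ _ c1 c1 q).
  by apply: cvgM; exact: c2.
have cE := compact_closedI cK clf.
have [||[x t] xtE xt_min] := @compact_EVT_min _ R D _ _ cE.
- by exists (p, r); split => //; apply: DK; rewrite DpM.
- exact: continuous_subspaceT.
move: xtE; rewrite inE => -[_ /= fxt]; exists x, t; split => // y u fyu.
have [DM|/ltW MD] := leP (D (y, u)) (M ^+ 2)%R.
  by apply: (xt_min (y, u)); rewrite inE; split => //; exact: DK.
apply: le_trans MD; rewrite -DpM.
by apply: (xt_min (p, r)); rewrite inE; split => //; apply: DK; rewrite DpM.
Qed.

(* The projection (x, t) onto the epigraph of a point (p, t0) below the graph
   has t > t0, so the normal it defines is not horizontal. *)
Lemma subgradient_near f (p : 'rV[R]_d) (r t0 : R) : closed_fun f ->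
  econvex_on setT f -> (forall x, f x != -oo) -> f p = r%:E -> (t0 < r)%R ->
  exists (x g : 'rV[R]_d) (t : R), [/\ f x = t%:E, subdifferential f x g,
    (t0 < t + dotp g (p - x))%R & (dotp (p - x) (p - x) <= (r - t0) ^+ 2)%R].
Proof.
move=> clf cvxf fNy fp t0r.
have fpr : f p <= r%:E by rewrite fp.
have [x [t [fxt xt_min]]] := epigraph_projection f p r t0 clf fpr.
(* Variational inequality of the projection: were [s] negative, a step [th] along the segment
   towards [(y, u)] would stay in the epigraph and come closer to [(p, t0)]. *)
have var y (u : R) : f y <= u%:E ->
    (0 <= dotp (x - p) (y - x) + (t - t0) * (u - t))%R.
  move=> fyu; rewrite leNgt; apply/negP.
  set s := (_ + _)%R => s0.
  pose N : R := (dotp (y - x) (y - x) + (u - t) ^+ 2)%R.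
  have N0 : (0 <= N)%R by rewrite addr_ge0 ?dotp_ge0 ?sqr_ge0.
  pose th : R := (- s / (N - s + 1))%R.
  have den0 : (0 < N - s + 1)%R by lra.
  have th0 : (0 < th)%R by rewrite divr_gt0//; lra.
  have thE : (th * (N - s + 1) = - s)%R by rewrite /th divfK// gt_eqF.
  have th1 : (th < 1)%R by rewrite /th ltr_pdivrMr//; lra.
  have th01 : (0 < th < 1)%R by rewrite th0.
  have fth : f (th *: y + (1 - th) *: x)%R <= (th * u + (1 - th) * t)%:E.
    apply: le_trans (cvxf _ _ _ _ _ th01) _ => //.
    rewrite (EFinD (th * u)) (EFinM th u) (EFinM (1 - th) t).
    by apply: leeD; apply: lee_wpmul2l => //; rewrite lee_fin; lra.
  have := xt_min _ _ fth.
  have -> : (th *: y + (1 - th) *: x - p = (x - p) + th *: (y - x))%R.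
    by apply/rowP => k; rewrite !mxE; ring.
  rewrite (dotp_sqrD (x - p)) !dotpZr dotpZl.
  move=> h; have : (0 <= th * (2 * s + th * N))%R.
    by rewrite /N /s; nra.
  by rewrite pmulr_rge0//; nra.
have s0 : (t0 <= t)%R.
  have := var x (t + 1)%R; rewrite subrr dotpr0 => h.
  suff : (0 <= 0 + (t - t0) * (t + 1 - t))%R by lra.
  by apply: h; rewrite (le_trans fxt)// lee_fin; lra.
(* If [t = t0], testing with [(p, r)] forces [x = p], hence [f p <= t0 < r]. *)
have t0t : (t0 < t)%R.
  rewrite lt_neqAle s0 andbT; apply/eqP => tt0.
  have /dotp_eq0/eqP : dotp (x - p) (x - p) = 0%R.
    apply/eqP; rewrite eq_le dotp_ge0 andbT.
    by have := var p r fpr; rewrite -(opprB x p) dotpNr tt0; lra.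
  rewrite subr_eq0 => /eqP xp; move: fxt.
  by rewrite xp fp -tt0 lee_fin leNgt t0r.
have fx : f x = t%:E.
  move: fxt (fNy x) (var x) => + + varx; case: (f x) varx => // u varx.
  rewrite !lee_fin => ut _; congr EFin; apply/eqP; rewrite eq_le ut/=.
  have := varx u (lexx _).
  rewrite subrr dotpr0 add0r pmulr_rge0 ?subr_gt0//; lra.
(* As [t - t0] and [r - t] are nonnegative with sum [r - t0], this yields the distance bound. *)
have nn : (dotp (x - p) (x - p) <= (t - t0) * (r - t))%R.
  have := var p r fpr; rewrite -(opprB x p) dotpNr; lra.
(* The normal [(p - x, t0 - t)] is scaled to have vertical component [-1]. *)
exists x, ((t - t0)^-1 *: (p - x))%R, t; split => //.
- move=> y; rewrite fx -EFinD; case fy : (f y) => [u| |].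
  + rewrite lee_fin; have := var y u; rewrite fy lexx => /(_ isT).
    rewrite -(opprB p x) dotpNl dotpZl => h.
    rewrite -lerBrDl ler_pdivrMl ?subr_gt0//; lra.
  + by rewrite leey.
  + by have := fNy y; rewrite fy.
- rewrite dotpZl; apply: (lt_le_trans t0t); rewrite lerDl.
  by rewrite mulr_ge0 ?dotp_ge0// invr_ge0 subr_ge0 ltW.
- rewrite -(opprB x p) dotpNl dotpNr opprK.
  have : (0 <= r - t)%R.
    by rewrite -(pmulr_rge0 _ (x := t - t0)) ?subr_gt0// (le_trans _ nn)// dotp_ge0.
  by nra.
Qed.

End ClosedConvex.

(** * Fenchel conjugates and biconjugation *)

Section Conjugate.
Context {R : realType} {d : nat}.
Implicit Types (f h : 'rV[R]_d -> \bar R) (x y g : 'rV[R]_d).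

Lemma fenchel_ge f g x : (dotp g x)%:E - f x <= fenchel f g.
Proof. by apply: ereal_sup_ubound; exists x. Qed.

Lemma fenchel_le f g M :
  (forall x, f x != +oo -> (dotp g x)%:E - f x <= M) -> fenchel f g <= M.
Proof.
move=> fM; apply: ge_ereal_sup => _ [x _ <-].
by have [->|/fM//] := eqVneq (f x) +oo; rewrite addeNy leNye.
Qed.

Lemma fenchel_gt f g M :
  M < fenchel f g -> exists2 x, f x != +oo & M < (dotp g x)%:E - f x.
Proof.
move=> /ereal_sup_gt[_ [x _ <-] Mx]; exists x => //.
by apply: contraTneq Mx => ->; rewrite addeNy ltNge leNye.
Qed.

Lemma fenchel_neqNy f g : (exists x, f x != +oo) -> fenchel f g != -oo.
Proof.
move=> [x fx]; rewrite -ltNye; apply: lt_le_trans (fenchel_ge f g x).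
by case: (f x) fx => //= r _; rewrite -EFinB ltNyr.
Qed.

Lemma closed_fenchel h : (forall g, h g != -oo) -> closed_fun (fenchel h).
Proof.
move=> hNy; apply: closed_fun_sup_affine => x t /fenchel_gt[g].
case hg : (h g) (hNy g) => [r| |]// _ _; rewrite -EFinB lte_fin => txg.
exists g, (- r)%R; split => [y|]; last by rewrite dotpC.
by rewrite dotpC EFinB -hg fenchel_ge.
Qed.

Lemma convex_fenchel h : (forall g, h g != -oo) -> econvex_on setT (fenchel h).
Proof.
move=> hNy x y t _ _ /andP[t0 t1]; apply: fenchel_le => g.
have := fenchel_ge h x g; have := fenchel_ge h y g.
case: (h g) (hNy g) => [r| |]// _; rewrite -!EFinB => yr xr _.
have -> : (dotp (t *: x + (1 - t) *: y) g - r =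
    t * (dotp x g - r) + (1 - t) * (dotp y g - r))%R.
  by rewrite dotpDl !dotpZl; ring.
rewrite EFinD (EFinM t) (EFinM (1 - t)).
by apply: leeD; apply: lee_wpmul2l => //; rewrite lee_fin; lra.
Qed.

(** Fenchel-Moreau for finite [f]: a subgradient [g] at a point near [x] gives an affine minorant
    whose value at [x] is within [e] of [f x], and testing the biconjugate with [g] recovers that
    value. *)
Lemma fenchelK f x : closed_fun f -> econvex_on setT f ->
  (forall y, f y \is a fin_num) -> fenchel (fenchel f) x = f x.
Proof.
move=> clf cvxf ffin; apply/eqP; rewrite eq_le; apply/andP; split.
  apply: fenchel_le => g _; have := fenchel_ge f g x.
  by rewrite leeBlDr// => h; rewrite dotpC; case: (fenchel f g) h => [r| |]//=;
    rewrite -(fineK (ffin x)) -?EFinD -?EFinB ?lee_fin ?addeNy ?leNye//; lra.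
have fNy y : f y != -oo by case: (f y) (ffin y).
rewrite -(fineK (ffin x)); apply/lee_addgt0Pr => e e0; rewrite -leeBlDr//.
have [||a [g [t [fa ga lt_t _]]]] :=
  subgradient_near f x (fine (f x)) (fine (f x) - e)%R clf cvxf fNy; first 2 last.
- have fg : fenchel f g <= (dotp g a - t)%:E.
    apply: fenchel_le => y _; have := ga y.
    rewrite fa -(fineK (ffin y)) -EFinD -EFinB !lee_fin dotpDr dotpNr; lra.
  have := fenchel_ge (fenchel f) x g; apply: le_trans.
  rewrite -EFinB (@le_trans _ _ ((dotp x g)%:E - (dotp g a - t)%:E))//.
    by rewrite -EFinB lee_fin; move: lt_t; rewrite (dotpC x) dotpDr dotpNr; lra.
  by rewrite leeB.
- by rewrite fineK.
- lra.
Qed.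

End Conjugate.

(** * Three-point inequalities and their duality *)

Section ThreePoint.
Context {R : realType} {d : nat}.
Implicit Types (f h : 'rV[R]_d -> \bar R) (x y g : 'rV[R]_d) (c rho delta : R).

(** When finite [f] has a subgradient [g] at [a], this follows by bounding [f b] above through
    inexact smoothness at [a], and [f] at the middle point below by [f a + tau <g, b - a>]; hence
    the error factor [tau] rather than [tau (1 - tau)]. *)
Definition inexact_descent c delta f := forall a b (tau : R), (0 < tau < 1)%R ->
  (1 - tau)%:E * f a + tau%:E * f b <= f ((1 - tau) *: a + tau *: b)%R +
    (tau * (c / 2 * dotp (b - a) (b - a) + delta))%:E.

(** The square on [1 - tau] comes from duality: for [c > 0] the supremum over [v] of
    [(1 - tau) <w, v> - c/2 |v|^2] is [(1 - tau)^2 |w|^2 / (2 c)]. *)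
Definition inexact_strong_convex rho delta h :=
  forall g g' (tau : R), (0 < tau < 1)%R ->
  h ((1 - tau) *: g + tau *: g')%R +
    (tau * (rho / 2 * (1 - tau) ^+ 2 * dotp (g' - g) (g' - g) - delta))%:E <=
  (1 - tau)%:E * h g + tau%:E * h g'.

(** Testing the conjugate at the middle point with the combination [z] of [g] and [g'] leaves a
    cross term in [<b - a, g' - g>], which the strong convexity of [h] absorbs by Young's
    inequality. Suprema over [g'] and then over [g] conclude. *)
Lemma inexact_descent_fenchel rho delta h : (0 < rho)%R ->
  (forall g, h g != -oo) -> proper_fun (fenchel h) ->
  inexact_strong_convex rho delta h ->
  inexact_descent rho^-1 delta (fenchel h).
Proof.
move=> rho0 hNy [FNy _] hsc a b tau tau01; have /andP[tau0 tau1] := tau01.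
have tau1' : (0 < 1 - tau)%R by lra.
set x := ((1 - tau) *: a + tau *: b)%R; set K := (tau * _)%R.
case Fx : (fenchel h x) (FNy x) => [X| |]// _; last by rewrite leey.
have real_bound g g' (G G' : R) : h g = G%:E -> h g' = G'%:E ->
    ((1 - tau) * (dotp a g - G) + tau * (dotp b g' - G') <= X + K)%R.
  move=> hg hg'; set z := ((1 - tau) *: g + tau *: g')%R.
  have := fenchel_ge h x z; rewrite Fx.
  have := hsc g g' tau tau01; rewrite -/z hg hg'.
  case: (h z) (hNy z) => [Z| |]// _; rewrite -?EFinB -?EFinM -!EFinD !lee_fin.
  set w := (g' - g)%R => Zle XZ.
  have xz : dotp x z = ((1 - tau) * dotp a g + tau * dotp b g' -
      tau * (1 - tau) * dotp (b - a) w)%R.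
    by rewrite /x /z /w !(dotpDl, dotpDr, dotpZl, dotpZr, dotpNl, dotpNr); ring.
  have young : ((1 - tau) * dotp (b - a) w - rho / 2 * (1 - tau) ^+ 2 * dotp w w
      <= rho^-1 / 2 * dotp (b - a) (b - a))%R.
    (* The gap in Young's inequality is this square divided by [2 rho]. *)
    have := dotp_ge0 ((b - a) + (- (rho * (1 - tau))) *: w).
    rewrite (dotp_sqrD (b - a)) !dotpZr dotpZl => sq.
    rewrite -subr_ge0 -(pmulr_rge0 _ (x := 2 * rho)); last by lra.
    apply: le_trans sq _; rewrite le_eqVlt; apply/orP; left; apply/eqP.
    by field; rewrite gt_eqF.
  by rewrite /K; nra.
have [g0 hg0] : exists g, h g != +oo.
  by have := FNy a; rewrite -ltNye => /fenchel_gt[g hg _]; exists g.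
have Fb g (G : R) : h g = G%:E ->
    fenchel h b <= (tau^-1 * (X + K - (1 - tau) * (dotp a g - G)))%:E.
  move=> hg; apply: fenchel_le => g'.
  case hg' : (h g') (hNy g') => [G'| |]// _ _.
  rewrite -EFinB lee_fin ler_pdivlMl//.
  by have := real_bound _ _ _ _ hg hg'; lra.
(* The value at [b] must be real before it can change sides for the supremum over [g]; [g0] provides
   the upper bound. *)
have [Y FbY] : exists Y : R, fenchel h b = Y%:E.
  case: (h g0) (hNy g0) hg0 (Fb g0) => [G| |]// _ _ /(_ _ erefl).
  by case: (fenchel h b) (FNy b) => [Y| |]// _ _; exists Y.
rewrite FbY -EFinM -EFinD -leeBrDr// -EFinB -lee_pdivlMl// -EFinM.
apply: fenchel_le => g.
case hg : (h g) (hNy g) => [G| |]// _ _.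
have := Fb _ _ hg; rewrite FbY -EFinB !lee_fin !ler_pdivlMl//; lra.
Qed.

(** Plain convexity serves the case [L(delta) = +oo], where [rho = 1/L(delta) = 0]. *)
Lemma inexact_strong_convex0 delta h : (0 <= delta)%R -> econvex_on setT h ->
  inexact_strong_convex 0 delta h.
Proof.
move=> delta0 cvxh g g' tau /andP[tau0 tau1].
rewrite mul0r !mul0r sub0r mulrN EFinN.
have h' := cvxh g g' (1 - tau)%R I I.
rewrite (_ : (1 - (1 - tau) = tau)%R) in h'; last by ring.
apply: le_trans (h' _); last by lra.
by rewrite leeBlDr// leeDl// lee_fin mulr_ge0// ltW.
Qed.

(* The three-point inequality is used at a, x and b = a + (x - a) / tau, where
   a is a subgradient point close to x - tau vopt and vopt maximises
   (1 - tau) <g' - g, v> - c/2 |v|^2 over v. *)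
Lemma inexact_strong_convex_fenchel c delta f : (0 < c)%R ->
  closed_fun f -> econvex_on setT f -> (forall x, f x \is a fin_num) ->
  (forall x y g, subdifferential f x g -> f y <= f x + (dotp g (y - x)%R)%:E
     + (c / 2 * dotp (y - x) (y - x) + delta)%:E) ->
  inexact_strong_convex c^-1 delta (fenchel f).
Proof.
move=> c0 clf cvxf ffin smooth g g' tau /andP[tau0 tau1].
have fNy x : f x != -oo by case: (f x) (ffin x).
have fpy x : f x != +oo by case: (f x) (ffin x).
have hNy u : fenchel f u != -oo by apply: fenchel_neqNy; exists 0%R.
have tau1' : (0 < 1 - tau)%R by lra.
case hg : (fenchel f g) (hNy g) => [H| |]// _; last first.
  rewrite (@gt0_muley _ (1 - tau)%:E) ?lte_fin//.
  case: (fenchel f g') (hNy g') => [H'| |]// _; rewrite ?addye ?leey//.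
  by rewrite gt0_muley ?lte_fin// leey.
case hg' : (fenchel f g') (hNy g') => [H'| |]// _; last first.
  by rewrite (@gt0_muley _ tau%:E) ?lte_fin// -EFinM addey// leey.
rewrite -leeBrDr//; apply: fenchel_le => x _.
set z := ((1 - tau) *: g + tau *: g')%R; set w := (g' - g)%R.
rewrite -(fineK (ffin x)) -!EFinM -EFinD -!EFinB lee_fin.
apply/ler_addgt0Pr => e e0.
pose vopt := ((1 - tau) / c *: w)%R.
(* For [a] within [r] of [p] and [v = (x - a) / tau], one has [p - a = tau (v - vopt)], so
   [c/2 |v - vopt|^2 <= e / tau]: an error [e] after multiplication by [tau]. *)
pose r := Num.sqrt (2 * tau * e / c).
have r0 : (0 < r)%R by rewrite sqrtr_gt0 divr_gt0// !mulr_gt0.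
have r2 : (r ^+ 2 = 2 * tau * e / c)%R.
  by rewrite sqr_sqrtr// ltW// divr_gt0// !mulr_gt0.
pose p := (x - tau *: vopt)%R.
have [||a [s [t [fa sa _]]]] :=
  subgradient_near f p (fine (f p)) (fine (f p) - r)%R clf cvxf fNy; first 2 last.
- rewrite (_ : fine (f p) - (fine (f p) - r) = r)%R; last by ring.
  rewrite r2 => pa.
  pose v := (tau^-1 *: (x - a))%R; pose b := (a + v)%R.
  have xE : x = (a + tau *: v)%R.
    by rewrite /v scalerA divff ?gt_eqF// scale1r addrC subrK.
  (* Four inequalities get combined: Fenchel-Young for [g] at [a] and for [g'] at [b], inexact
     smoothness from [a] to [b], and the subgradient [s] from [a] to [x = (1 - tau) a + tau b]. *)
  have := fenchel_ge f g a; rewrite hg fa -EFinB lee_fin => Ha.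
  have := fenchel_ge f g' b; rewrite hg' -(fineK (ffin b)) -EFinB lee_fin => Hb.
  have := smooth a b s sa; rewrite fa -(fineK (ffin b)) -!EFinD lee_fin.
  have ba : (b - a = v)%R by rewrite /b addrAC subrr add0r.
  rewrite ba => fb; have := sa x; rewrite fa -(fineK (ffin x)) -EFinD lee_fin.
  have xa : (x - a = tau *: v)%R by rewrite {1}xE addrAC subrr add0r.
  rewrite xa dotpZr => fx.
  have pv : (p - a = tau *: (v + (- 1) *: vopt))%R.
    by rewrite /p {1}xE; apply/rowP => k; rewrite !mxE; ring.
  move: pa; rewrite pv dotpZl dotpZr dotp_sqrD scaleN1r dotpNr dotpNl dotpNr.
  rewrite (dotpZr _ v w) (dotpZr _ _ w) (dotpZl _ w w) (dotpC v w) => pa.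
  have zx : dotp z x = ((1 - tau) * dotp g a + tau * dotp g' b -
      tau * (1 - tau) * dotp w v)%R.
    by rewrite /z /w {1}xE /b !(dotpDl, dotpDr, dotpZl, dotpZr, dotpNl, dotpNr); ring.
  (* The left side is the completed square [c/2 |v - vopt|^2]. *)
  have young : (c / 2 * dotp v v - (1 - tau) * dotp w v +
      c^-1 / 2 * (1 - tau) ^+ 2 * dotp w w <= e / tau)%R.
    have k0 : (0 <= c / (2 * tau ^+ 2))%R.
      by rewrite divr_ge0 ?mulr_ge0 ?exprn_ge0//; lra.
    have := ler_wpM2l k0 pa; congr (_ <= _)%R; field; rewrite ?gt_eqF//.
  have : (tau * (c / 2 * dotp v v - (1 - tau) * dotp w v +
      c^-1 / 2 * (1 - tau) ^+ 2 * dotp w w) <= e)%R.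
    by move: young; rewrite ler_pdivlMr// mulrC.
  by move: fb; rewrite zx; nra.
- by rewrite fineK.
- lra.
Qed.

(** The point [x] is written as a combination of [y] and a point [a] slightly behind [x], where [g]
    bounds [f a] from below. Descent is asked for [c] strictly above [L delta] because the infimum
    or supremum defining a modulus may not be attained. *)
Lemma inexactly_smooth_of_descent (L : R -> \bar R) f :
  closed_fun f -> econvex_on setT f -> proper_fun f ->
  (forall delta, (0 <= delta)%R -> 0 <= L delta) ->
  (forall delta c, (0 <= delta)%R -> L delta < c%:E ->
    inexact_descent c delta f) ->
  inexactly_smooth L f.
Proof.
move=> clf cvxf pf L0 fL; split=> // x y g delta gx delta0.
have [fNy [q fq]] := pf.
case Lc : (L delta) (L0 _ delta0) => [c| |]//; rewrite lee_fin => c0 _.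
(* A subgradient at a point of value [+oo] would force [f q = +oo]. *)
case fx : (f x) (fNy x) => [X| |]// _; last first.
  by have := gx q; rewrite fx addye// leye_eq => /eqP fqy; rewrite fqy eqxx in fq.
have ltLc c' : (c < c')%R -> L delta < c'%:E by rewrite Lc lte_fin.
rewrite sqr_enorm inver pnatr_eq0/= -!EFinM -!EFinD.
set v := (y - x)%R; set V := dotp v v; set G := dotp g v.
have V0 : (0 <= V)%R := dotp_ge0 v.
apply/lee_addgt0Pr => e e0.
(* Replacing [c] by [c'] costs at most [e] in [c V]; [t] below makes [c' V t (2 + t)] at most [e].
   Both are halved by the factor 1/2, so the total error is [e]. *)
pose c' := (c + e / (V + 1))%R.
have cc' : (c < c')%R by rewrite ltrDl divr_gt0//; lra.
have c'V : (c' * V <= c * V + e)%R.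
  rewrite /c' mulrDl lerD2l mulrAC ler_pdivrMr; last by lra.
  by rewrite ler_pM2l//; lra.
have c'V0 : (0 <= c' * V)%R by rewrite mulr_ge0//; lra.
pose t := (e / (e + 3 * (c' * V)))%R.
have den0 : (0 < e + 3 * (c' * V))%R by lra.
have t0 : (0 < t)%R by rewrite divr_gt0.
have t1 : (t <= 1)%R by rewrite ler_pdivrMr//; lra.
have tE : (t * (e + 3 * (c' * V)) = e)%R by rewrite divfK// gt_eqF.
(* With [a = x - t v], the weights [s] and [t s] give [x = s a + t s y]. *)
pose s := ((1 + t)^-1)%R.
have s0 : (0 < s)%R by rewrite invr_gt0; lra.
have sE : (s * (1 + t) = 1)%R by rewrite mulVf// gt_eqF//; lra.
have tau01 : (0 < t * s < 1)%R by rewrite mulr_gt0//=; nra.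
have tauC : (1 - t * s = s)%R by rewrite -sE; ring.
pose a := (x - t *: v)%R.
have := fL delta c' delta0 (ltLc _ cc') a y (t * s)%R tau01.
have -> : ((1 - t * s) *: a + (t * s) *: y = x)%R.
  rewrite tauC -[RHS]scale1r -sE /a /v; apply/rowP => k; rewrite !mxE; ring.
have -> : (y - a = (1 + t) *: v)%R.
  by rewrite /a /v; apply/rowP => k; rewrite !mxE; ring.
rewrite tauC dotpZl dotpZr -/V fx.
have := gx a; rewrite fx (_ : a - x = - t *: v)%R; last first.
  by rewrite /a scaleNr addrAC subrr add0r.
rewrite dotpZr -/G -EFinD.
case: (f a) (fNy a) => [A| |]// _; last first.
  move=> _; rewrite gt0_muley ?lte_fin//.
  case: (f y) (fNy y) => [Y| |]// _; rewrite ?gt0_muley ?lte_fin ?addye//.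
    by case/andP: tau01.
rewrite lee_fin => XA; case: (f y) (fNy y) => [Y| |]// _; last first.
  by rewrite gt0_muley ?lte_fin//; case/andP: tau01.
rewrite -!EFinM -!EFinD !lee_fin => h.
have sXA : (s * (X - t * G) <= s * A)%R by rewrite ler_pM2l//; lra.
have {}h : (t * s * Y <= t * s * (X + G + (c' / 2 * ((1 + t) ^+ 2 * V) + delta)))%R.
  have -> : (t * s * (X + G + (c' / 2 * ((1 + t) ^+ 2 * V) + delta)) =
      (s * (1 + t)) * X - s * (X - t * G) +
      t * s * (c' / 2 * ((1 + t) * ((1 + t) * V)) + delta))%R by ring.
  by rewrite sE; lra.
move: h; rewrite ler_pM2l; last by case/andP: tau01.
have : (c' * V * (t * (2 + t)) <= e)%R by nra.
by nra.
Qed.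

End ThreePoint.

(** * Sums and maxima of finite families *)

Section Families.
Context {R : realType} {d m : nat}.
Implicit Types (f h : 'I_m -> 'rV[R]_d -> \bar R) (c rho delta : 'I_m -> R).

Lemma sume_neqNy (F : 'I_m -> \bar R) :
  (forall i, F i != -oo) -> \sum_i F i != -oo.
Proof. by move=> FNy; apply/eqP => /esum_eqNyP[i [_ _ /eqP]]; apply/negP. Qed.

Lemma sume_comb (F G : 'I_m -> \bar R) (s t : R) :
  (forall i, F i != -oo) -> (forall i, G i != -oo) ->
  \sum_i (s%:E * F i + t%:E * G i) = s%:E * \sum_i F i + t%:E * \sum_i G i.
Proof.
move=> FNy GNy; rewrite big_split/= !fin_num_sume_distrr// => i j _ _;
  by rewrite ltninfty_adde_def// inE ltNye.
Qed.

Lemma econvex_on_sum f : (forall i x, f i x != -oo) ->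
  (forall i, econvex_on setT (f i)) -> econvex_on setT (fun x => \sum_i f i x).
Proof.
move=> fNy cvxf x y t _ _ t01; rewrite -sume_comb//.
by apply: lee_sum => i _; exact: cvxf.
Qed.

Lemma inexact_descent_sum f c delta : (forall i x, f i x != -oo) ->
  (forall i, inexact_descent (c i) (delta i) (f i)) ->
  inexact_descent (\sum_i c i)%R (\sum_i delta i)%R (fun x => \sum_i f i x).
Proof.
move=> fNy fd a b tau tau01; rewrite -sume_comb// !mulr_suml -big_split mulr_sumr.
by rewrite -sumEFin -big_split; apply: lee_sum => i _; exact: fd.
Qed.

Lemma inexact_strong_convex_sum h rho delta : (forall i g, h i g != -oo) ->
  (forall i, inexact_strong_convex (rho i) (delta i) (h i)) ->
  inexact_strong_convex (\sum_i rho i)%R (\sum_i delta i)%R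
    (fun g => \sum_i h i g).
Proof.
move=> hNy hsc g g' tau tau01; rewrite -sume_comb// !mulr_suml -sumrB mulr_sumr.
by rewrite -sumEFin -big_split; apply: lee_sum => i _; exact: hsc.
Qed.

Lemma inexact_strong_convex_max h (rho delta : R) :
  (forall i, inexact_strong_convex rho delta (h i)) ->
  inexact_strong_convex rho delta (fun g => \big[maxe/-oo]_i h i g).
Proof.
move=> hsc g g' tau tau01; have /andP[tau0 tau1] := tau01.
rewrite -leeBrDr//; apply/bigmax_leP; split=> [|i _]; first exact: leNye.
rewrite leeBrDr//; apply: le_trans (hsc i g g' tau tau01) _.
by apply: leeD; apply: lee_wpmul2l; rewrite ?lee_fin ?le_bigmax//; lra.
Qed.

(** Affine minorants of the [f i] that are nearly exact at [x] add up to one of the sum. *)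
Lemma closed_fun_sum f : (forall i x, f i x \is a fin_num) ->
  (forall i, closed_fun (f i)) -> (forall i, econvex_on setT (f i)) ->
  closed_fun (fun x => \sum_i f i x).
Proof.
move=> ffin clf cvxf; apply: closed_fun_sup_affine => x t.
pose F := (\sum_i fine (f i x))%R.
have -> : \sum_i f i x = F%:E.
  by rewrite -sumEFin; apply: eq_bigr => i _; rewrite fineK.
(* Dividing by [m.+1] keeps the total loss [m e] strictly below [F - t], also for [m = 0]. *)
rewrite lte_fin => tF; pose e := ((F - t) / m.+1%:R)%R.
have e0 : (0 < e)%R by rewrite divr_gt0 ?subr_gt0.
have /choice[gc gcP] : forall i, exists gc : 'rV[R]_d * R,
    (forall y, (dotp gc.1 y + gc.2)%:E <= f i y) /\
    (fine (f i x) - e <= dotp gc.1 x + gc.2)%R.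
  move=> i; have fNy y : f i y != -oo by case: (f i y) (ffin i y).
  have [||a [g [r [fa ga lt_r _]]]] := subgradient_near (f i) x (fine (f i x))
    (fine (f i x) - e)%R (clf i) (cvxf i) fNy; first 2 last.
  - exists (g, r - dotp g a)%R; split=> [y|]/=.
      apply: le_trans (ga y); rewrite fa -EFinD lee_fin dotpDr dotpNr; lra.
    by move: lt_r; rewrite dotpDr dotpNr; lra.
  - by rewrite fineK.
  - lra.
exists (\sum_i (gc i).1)%R, (\sum_i (gc i).2)%R.
have dE y : (dotp (\sum_i (gc i).1) y + \sum_i (gc i).2 =
    \sum_i (dotp (gc i).1 y + (gc i).2))%R.
  rewrite big_split/=; congr (_ + _)%R.
  elim/big_ind2: _ => [|u1 u2 v1 v2 <- <-|//]; last by rewrite dotpDl.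
  by rewrite dotpC dotpr0.
split=> [y|]; rewrite dE.
  by rewrite -sumEFin; apply: lee_sum => i _; case: (gcP i).
have : (F - m%:R * e <= \sum_i (dotp (gc i).1 x + (gc i).2))%R.
  apply: (@le_trans _ _ (\sum_i (fine (f i x) - e))%R).
    by rewrite sumrB sumr_const card_ord mulr_natl.
  by apply: ler_sum => i _; case: (gcP i).
apply: lt_le_trans; have eE : (e * m.+1%:R = F - t)%R by rewrite divfK// pnatr_eq0.
by move: eE; rewrite -natr1; lra.
Qed.

End Families.

(** * From moduli to three-point inequalities *)

Section Moduli.
Context {R : realType} {d : nat}.
Implicit Types (L : R -> \bar R) (f h : 'rV[R]_d -> \bar R) (c rho delta : R).

Lemma inexact_descent_le c c' delta f : (c <= c')%R ->
  inexact_descent c delta f -> inexact_descent c' delta f.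
Proof.
move=> cc' fd a b tau tau01; apply: le_trans (fd a b tau tau01) _.
have /andP[tau0 _] := tau01; apply: leeD => //; rewrite lee_fin ler_pM2l// lerD2r.
by rewrite ler_wpM2r ?dotp_ge0//; lra.
Qed.

Lemma inexact_strong_convex_le rho rho' delta h : (rho' <= rho)%R ->
  inexact_strong_convex rho delta h -> inexact_strong_convex rho' delta h.
Proof.
move=> rr hsc a b tau tau01; apply: le_trans (hsc a b tau tau01).
have /andP[tau0 _] := tau01; apply: leeD => //; rewrite lee_fin ler_pM2l// lerD2r.
by rewrite ler_wpM2r ?dotp_ge0// ler_wpM2r ?sqr_ge0//; lra.
Qed.

(** Since [L 1] is finite, the inequality at a single point with a subgradient is a finite quadratic
    upper bound everywhere. *)
Lemma inexactly_smooth_fin_num L f x :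
  admissible L -> inexactly_smooth L f -> f x \is a fin_num.
Proof.
move=> Ladm [clf cvxf [fNy [p fp]] smooth].
case fpE : (f p) (fNy p) fp => [r| |]// _ _.
have [|a [g [t [fa ga _ _]]]] :=
  subgradient_near f p r (r - 1)%R clf cvxf fNy fpE; first lra.
have := smooth a x g 1%R ga ler01 (admissible_fin Ladm ltr01).
have := admissible_fin Ladm ltr01; have := admissible_gt0 Ladm ler01.
case: (L 1%R) => [l| |]// _ _; rewrite fa inver pnatr_eq0/=.
rewrite -!EFinM -!EFinD => fx; rewrite fin_numE fNy/= -ltey.
by apply: le_lt_trans fx _; rewrite ltry.
Qed.

Lemma admissible_inv_fin_num L delta :
  admissible L -> (0 <= delta)%R -> (L delta)^-1 \is a fin_num.
Proof.
move=> Ladm delta0; have := admissible_gt0 Ladm delta0.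
by case: (L delta) => [l| |]// l0; rewrite ?invey// inver gt_eqF.
Qed.

Lemma inexactly_smooth_fenchel_strong_convex L f delta :
  admissible L -> inexactly_smooth L f -> (0 <= delta)%R ->
  inexact_strong_convex (fine (L delta)^-1) delta (fenchel f).
Proof.
move=> Ladm fs delta0; have ffin x := inexactly_smooth_fin_num L f x Ladm fs.
have [clf cvxf [fNy _] smooth] := fs.
have := admissible_gt0 Ladm delta0.
case Ld : (L delta) => [l| |]// l0; last first.
  by rewrite invey; apply: inexact_strong_convex0 => //; exact: convex_fenchel.
rewrite inver gt_eqF//=; apply: inexact_strong_convex_fenchel => // x y g gx.
have := smooth x y g delta gx delta0; rewrite Ld ltry => /(_ isT).
by rewrite sqr_enorm inver pnatr_eq0/= -!EFinM EFinD addeA.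
Qed.

(** Two conjugations carry the inequality from points with a subgradient, only known to be dense, to
    all points. *)
Lemma inexactly_smooth_descent L f delta c :
  admissible L -> inexactly_smooth L f -> (0 <= delta)%R -> L delta = c%:E ->
  inexact_descent c delta f.
Proof.
move=> Ladm fs delta0 Lc; have ffin x := inexactly_smooth_fin_num L f x Ladm fs.
have [clf cvxf pf _] := fs; have [fNy [q fq]] := pf.
have c0 : (0 < c)%R by rewrite -lte_fin -Lc admissible_gt0.
have fK : fenchel (fenchel f) = f by apply/funext => x; rewrite fenchelK.
rewrite -fK -[c]invrK; apply: inexact_descent_fenchel.
- by rewrite invr_gt0.
- by move=> g; apply: fenchel_neqNy; exists q.
- by rewrite fK.
- have := inexactly_smooth_fenchel_strong_convex _ _ _ Ladm fs delta0.
  by rewrite Lc inver gt_eqF.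
Qed.

End Moduli.

(** * The three calculus rules *)

Theorem lemma2p6 (R : realType) (d m : nat) (m_gt0 : (0 < m)%N)
    (L : 'I_m -> R -> \bar R) (f : 'I_m -> 'rV[R]_d -> \bar R)
    (L_adm : forall i : 'I_m, admissible (L i))
    (f_smooth : forall i : 'I_m, inexactly_smooth (L i) (f i)) :
  [/\ inexactly_smooth (sum_modulus L) (fun x => \sum_i f i x),
      proper_fun (fenchel (fun g => \big[maxe/-oo]_i fenchel (f i) g)) ->
      inexactly_smooth (max_modulus L)
        (fenchel (fun g => \big[maxe/-oo]_i fenchel (f i) g))
    & proper_fun (fenchel (fun g => \sum_i fenchel (f i) g)) ->
      inexactly_smooth (infconv_modulus L)
        (fenchel (fun g => \sum_i fenchel (f i) g))].
Proof.
pose i0 := Ordinal m_gt0.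
have ffin i x : f i x \is a fin_num by exact: inexactly_smooth_fin_num (f_smooth i).
have fNy i x : f i x != -oo by case: (f i x) (ffin i x).
have hNy i g : fenchel (f i) g != -oo.
  by apply: fenchel_neqNy; exists 0%R; case: (f i 0%R) (ffin i 0%R).
have L_gt0 i delta : (0 <= delta)%R -> 0 < L i delta.
  by move=> ?; exact: admissible_gt0.
have h_strong i delta := inexactly_smooth_fenchel_strong_convex _ _ delta
  (L_adm i) (f_smooth i).
split.
- apply: inexactly_smooth_of_descent.
  + exact: (closed_fun_sum f ffin (fun i => inexactly_smooth_closed (f_smooth i))
      (fun i => inexactly_smooth_convex (f_smooth i))).
  + exact: (econvex_on_sum f fNy (fun i => inexactly_smooth_convex (f_smooth i))).
  + split=> [x|]; first exact: sume_neqNy.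
    by exists 0%R; rewrite -ltey; apply: lte_sum_pinfty => i _; rewrite ltey_eq ffin.
  + move=> delta _; apply: le_ereal_inf_tmp => _ [e [_ e0] <-].
    by apply: sume_ge0 => i _; rewrite ltW// L_gt0.
  (* Some splitting has a sum below [c]; its terms are positive, hence all finite. *)
  + move=> delta c _ /ereal_inf_lt[_ [e [<- e0] <-]] Lc.
    have Lfin i : L i (e i) \is a fin_num.
      have /sum_fin_numP : \sum_i L i (e i) \is a fin_num.
        rewrite ge0_fin_numE ?(lt_trans Lc) ?ltry// sume_ge0// => j _.
        by rewrite ltW// L_gt0.
      by apply; rewrite ?mem_index_enum.
    apply: (@inexact_descent_le _ _ (\sum_i fine (L i (e i)))%R).
      rewrite -lee_fin -sumEFin; apply: le_trans (ltW Lc).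
      by apply: lee_sum => i _; rewrite fineK.
    apply: inexact_descent_sum => // i.
    by apply: inexactly_smooth_descent (f_smooth i) _ _ => //; rewrite fineK.
- move=> pF; set h := fun g => _.
  (* The maximum starts from [-oo]; the index [i0], available as [m > 0], keeps [h] above it. *)
  have hmaxNy g : h g != -oo.
    rewrite -ltNye; apply: (@lt_le_trans _ _ (fenchel (f i0) g)).
      by rewrite ltNye.
    by rewrite /h le_bigmax.
  apply: inexactly_smooth_of_descent => //.
  + exact: closed_fenchel.
  + exact: convex_fenchel.
  + move=> delta delta0; apply: le_trans (ltW (L_gt0 i0 _ delta0)) _.
    by rewrite /max_modulus (le_bigmax _ (fun i => L i delta)).
  + move=> delta c delta0 Lc.
    have Lic i : L i delta < c%:E.
      by apply: le_lt_trans Lc; rewrite /max_modulus (le_bigmax _ (fun i => L i delta)).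
    have c0 : (0 < c)%R by rewrite -lte_fin (lt_trans (L_gt0 i0 _ delta0)).
    rewrite -[c]invrK; apply: inexact_descent_fenchel => //; first by rewrite invr_gt0.
    (* All indices share [delta] and the common constant [1/c <= 1/L_i(delta)]. *)
    apply: inexact_strong_convex_max => i.
    apply: inexact_strong_convex_le (h_strong i _ delta0).
    have := L_gt0 i _ delta0; move: (Lic i).
    case: (L i delta) => [l| |]//; rewrite !lte_fin => lc l0.
    by rewrite inver gt_eqF//= lef_pV2 ?posrE// ltW.
- move=> pF; set h := fun g => _.
  have hsumNy g : h g != -oo by exact: sume_neqNy.
  have sup_ge0 delta : (0 <= delta)%R ->
      0 <= ereal_sup [set \sum_i (L i (e i))^-1 | e in splittings delta].
    (* Giving all of [delta] to [i0] shows that splittings exist, so the supremum is not the [-oo]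
       of an empty set. *)
    move=> delta0; pose e i := if i == i0 then delta else 0%R.
    have e0 i : (0 <= e i)%R by rewrite /e; case: ifP.
    apply: (@le_trans _ _ (\sum_i (L i (e i))^-1)).
      by apply: sume_ge0 => i _; rewrite inve_ge0 ltW// L_gt0.
    apply: ereal_sup_ubound; exists e => //; split=> //.
    by rewrite /e -big_mkcond/= big_pred1_eq.
  apply: inexactly_smooth_of_descent => //.
  + exact: closed_fenchel.
  + exact: convex_fenchel.
  + by move=> delta delta0; rewrite inve_ge0 sup_ge0.
  + move=> delta c delta0 Lc.
    have c0 : (0 < c)%R.
      by rewrite -lte_fin (le_lt_trans _ Lc)// inve_ge0 sup_ge0.
    (* Inverting turns the bound into [1/c] below the supremum, so some splitting has
       [1/c < \sum_i 1/L_i(e_i)]. *)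
    move: Lc; rewrite /infconv_modulus inve_plt ?inE ?sup_ge0//=; last exact/ltW.
    rewrite inver gt_eqF// => /ereal_sup_gt[_ [e [<- e0] <-]] Lc.
    rewrite -[c]invrK; apply: inexact_descent_fenchel => //; first by rewrite invr_gt0.
    apply: (@inexact_strong_convex_le _ _ (\sum_i fine (L i (e i))^-1)%R).
      rewrite -lee_fin -sumEFin; apply: le_trans (ltW Lc) _.
      by apply: lee_sum => i _; rewrite fineK// admissible_inv_fin_num.
    by apply: inexact_strong_convex_sum => // i; exact: h_strong.
Qed.
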